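(* Let $n\ge 3$ and $k\ge 3$. For every $\alpha\in\mathbf{A}_k(n)\setminus\{r_{n,k}\}$, at least one of $\mathrm{LastNonMax}(\alpha)$, $\mathrm{LastSymbol}(\alpha)$, $\mathrm{FirstNonMin}(\alpha)$, $\mathrm{SecondLastNonMax}(\alpha)$ lies in $\mathbf{A}_k(n)$, so $\mathrm{Par}(\alpha)\in\mathbf{A}_k(n)$ is well defined. Moreover, for every $\alpha\in\mathbf{A}_k(n)$ there is $t\ge 0$ with $\mathrm{Par}^t(\alpha)=r_{n,k}$. Consequently the relation $\alpha\mapsto\mathrm{Par}(\alpha)$ defines a rooted tree with vertex set $\mathbf{A}_k(n)$ and root $r_{n,k}$, in which each non-root $\alpha$ and its parent $\mathrm{Par}(\alpha)$ have rotations that differ in exactly one (first) position.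
   Context: Let $\Sigma=\{0,1,\dots,k-1\}$. Strings are compared lexicographically ($\alpha<\beta$ if $\alpha$ is a proper prefix of $\beta$, or $\alpha$ has the smaller symbol at the first index where they differ). For $\alpha=a_1\cdots a_n$, $\alpha^R=a_n\cdots a_1$; $[\alpha]$ is the set of rotations of $\alpha$. $\alpha$ is a necklace if it is the lexicographically smallest element of $[\alpha]$; a bracelet if it is the lexicographically smallest element of $[\alpha]\cup[\alpha^R]$. A necklace $\alpha$ is symmetric if $\alpha^R\in[\alpha]$, asymmetric otherwise. $\mathbf{A}_k(n)$ is the set of asymmetric bracelets of length $n$ over $\Sigma$. $r_{n,k}=0^{n-2}(k-2)(k-1)$. Operations on $\alpha=a_1\cdots a_n$: $\mathrm{LastNonMax}(\alpha)=a_1\cdots a_{j-1}(a_j+1)(k-1)^{n-j}$, where $j$ is the index of the last symbol different from $k-1$; $\mathrm{LastSymbol}(\alpha)$ is the necklace (smallest rotation) of $a_1\cdots a_{n-1}((a_n+1)\bmod k)$; $\mathrm{FirstNonMin}(\alpha)=0^{i-1}(a_i-1)a_{i+1}\cdots a_n$, where $i$ is the index of the first nonzero symbol; $\mathrm{SecondLastNonMax}(\alpha)=a_1\cdots a_{\ell-1}(a_\ell+1)a_{\ell+1}\cdots a_n$, where $\ell$ is the index of the second-last symbol different from $k-1$. Parent rule: for $\alpha\in\mathbf{A}_k(n)\setminus\{r_{n,k}\}$, $\mathrm{Par}(\alpha)$ is the first string in the list $\langle \mathrm{LastNonMax}(\alpha),\mathrm{LastSymbol}(\alpha),\mathrm{FirstNonMin}(\alpha),\mathrm{SecondLastNonMax}(\alpha)\rangle$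 that belongs to $\mathbf{A}_k(n)$. $\mathrm{Par}^t$ denotes $t$-fold iteration, $\mathrm{Par}^0(\alpha)=\alpha$. *)

(* Defs.v *)
From mathcomp Require Import all_boot.
Set Implicit Arguments. Unset Strict Implicit. Unset Printing Implicit Defensive.

Fixpoint lexle (a b : seq nat) : bool :=
  match a, b with
  | [::], _ => true
  | _ :: _, [::] => false
  | x :: a', y :: b' => (x < y) || ((x == y) && lexle a' b')
  end.

Definition is_word (k n : nat) (s : seq nat) : bool :=
  (size s == n) && all (fun a => a < k) s.

Definition rotations (s : seq nat) : seq (seq nat) :=
  [seq rot i s | i <- iota 0 (size s)].

Definition is_necklace (s : seq nat) : bool := all (lexle s) (rotations s).

Definition is_bracelet (s : seq nat) : bool :=
  all (lexle s) (rotations s ++ rotations (rev s)).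

Definition symmetric_necklace (s : seq nat) : bool :=
  is_necklace s && (rev s \in rotations s).

Definition asym_bracelet (k n : nat) (s : seq nat) : bool :=
  [&& is_word k n s, is_bracelet s & ~~ symmetric_necklace s].

Definition rnk (n k : nat) : seq nat := nseq (n - 2) 0 ++ [:: k - 2; k - 1].

Definition neck (s : seq nat) : seq nat :=
  foldr (fun t m => if lexle t m then t else m) s (rotations s).

Definition nonmax_idx (k : nat) (s : seq nat) : seq nat :=
  [seq i <- iota 0 (size s) | nth 0 s i != k - 1].

(* The operations; when the required index does not exist (never the case
   for an asymmetric bracelet) they return s unchanged. *)
Definition LastNonMax (k : nat) (s : seq nat) : seq nat :=
  let idx := nonmax_idx k s in
  if idx is [::] then s else
  let j := last 0 idx in
  take j s ++ (nth 0 s j).+1 :: nseq (size s - j.+1) (k - 1).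

Definition LastSymbol (k : nat) (s : seq nat) : seq nat :=
  neck (rcons (take (size s - 1) s) ((last 0 s).+1 %% k)).

Definition FirstNonMin (s : seq nat) : seq nat :=
  let i := find (fun a => a != 0) s in
  if i == size s then s else
  take i s ++ (nth 0 s i).-1 :: drop i.+1 s.

Definition SecondLastNonMax (k : nat) (s : seq nat) : seq nat :=
  let idx := nonmax_idx k s in
  if size idx < 2 then s else
  let l := nth 0 idx (size idx - 2) in
  set_nth 0 s l (nth 0 s l).+1.

Definition candidates (k : nat) (s : seq nat) : seq (seq nat) :=
  [:: LastNonMax k s; LastSymbol k s; FirstNonMin s; SecondLastNonMax k s].

Definition Par (k n : nat) (s : seq nat) : seq nat :=
  head s [seq c <- candidates k s | asym_bracelet k n c].

(* Main.v *)
Require Import Defs.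
From mathcomp Require Import all_boot zify.
Set Implicit Arguments. Unset Strict Implicit. Unset Printing Implicit Defensive.

(** Let z be the number of leading zeros of an asymmetric bracelet a, let a_z be
    its first nonzero symbol and a_j its last symbol different from k-1.
    LastNonMax always yields a bracelet.  If that bracelet is symmetric, it is
    a product X Y of two palindromes, and comparing a with its reversal read
    from the end of X forces Y to be a power of k-1, so that
    a = X (k-1)^p (k-2) (k-1)^m with p < m.  FirstNonMin yields an asymmetric
    bracelet as soon as a_z >= 2 or z = 0.  LastSymbol does so, for a as above,
    as soon as a_z is smaller than the second-last symbol.  If all three fail,
    then a_z = 1, k = 3 and a = X 12 with X a palindrome ending in 00 or 10, and
    SecondLastNonMax succeeds.

    Every step of the parent map improves a lexicographic measure: the number
    of leading zeros never decreases and LastSymbol increases it; for a fixed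
    number of leading zeros, a_z (replaced by 0 if everything after it is k-1)
    never increases and FirstNonMin decreases it; LastNonMax and
    SecondLastNonMax increase the sum of the symbols. *)

(** * Cyclic words as functions, their comparisons and reindexings *)

(* [f \o fwd n i] and [f \o bwd n i] are the cyclic word [f 0], ..., [f (n - 1)]
   read forwards and backwards from position [i]. *)
Definition fwd (n i t : nat) : nat := if i + t < n then i + t else i + t - n.
Definition bwd (n i t : nat) : nat := if t <= i then i - t else n + i - t.

Definition flt (n : nat) (f g : nat -> nat) : Prop :=
  exists p, [/\ p < n, (forall t, t < p -> f t = g t) & f p < g p].
Definition feq (n : nat) (f g : nat -> nat) : Prop := forall t, t < n -> f t = g t.
Definition fle (n : nat) (f g : nat -> nat) : Prop := flt n f g \/ feq n f g.

(** Weak for rotations, strict for rotations of the reversal: equality with one of the latter is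
    exactly symmetry, so this characterises asymmetric bracelets ([asymP]). *)
Definition fasym (n : nat) (f : nat -> nat) : Prop :=
  (forall i, i < n -> fle n f (f \o fwd n i)) /\
  (forall i, i < n -> flt n f (f \o bwd n i)).

Definition upd (f : nat -> nat) (j v t : nat) : nat := if t == j then v else f t.

Definition permutes (n : nat) (s : nat -> nat) : Prop :=
  perm_eq (map s (iota 0 n)) (iota 0 n).

Lemma permutes_lt n s t : permutes n s -> t < n -> s t < n.
Proof.
move=> ps tn; have : s t \in map s (iota 0 n) by apply: map_f; rewrite mem_iota.
by rewrite (perm_mem ps) mem_iota.
Qed.

Lemma permutes_surj n s j : permutes n s -> j < n -> exists2 q, q < n & s q = j.
Proof.
move=> ps jn; have : j \in map s (iota 0 n) by rewrite (perm_mem ps) mem_iota.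
by case/mapP=> q; rewrite mem_iota /= add0n => qn ->; exists q.
Qed.

Lemma permutes_inj n s t u : permutes n s -> t < n -> u < n -> s t = s u -> t = u.
Proof.
move=> ps tn un e.
have us : uniq (map s (iota 0 n)) by rewrite (perm_uniq ps) iota_uniq.
have := @nth_uniq _ 0 (map s (iota 0 n)) t u; rewrite !size_map !size_iota => /(_ tn un us).
by rewrite !(nth_map 0) ?size_iota // !nth_iota // !add0n e eqxx => /esym/eqP.
Qed.

Lemma permutes_inj_on n s : (forall t, t < n -> s t < n) ->
  (forall t u, t < n -> u < n -> s t = s u -> t = u) -> permutes n s.
Proof.
move=> sn sI; apply: uniq_perm; rewrite ?iota_uniq //.
  by rewrite map_inj_in_uniq ?iota_uniq // => t u; rewrite !mem_iota; exact: sI.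
have us : uniq (map s (iota 0 n)).
  by rewrite map_inj_in_uniq ?iota_uniq // => t u; rewrite !mem_iota; exact: sI.
apply: (uniq_min_size us _ _).2; last by rewrite size_map.
by move=> _ /mapP[t + ->]; rewrite !mem_iota; exact: sn.
Qed.

Lemma permutes_fwd n i : i < n -> permutes n (fwd n i).
Proof.
move=> lt_in; apply: permutes_inj_on => [t|t u]; rewrite /fwd; first by case: ifP; lia.
by case: ifP; case: ifP; lia.
Qed.

Lemma permutes_bwd n i : i < n -> permutes n (bwd n i).
Proof.
move=> lt_in; apply: permutes_inj_on => [t|t u]; rewrite /bwd; first by case: ifP; lia.
by case: ifP; case: ifP; lia.
Qed.

Lemma updE f j v t : upd f j v t = if t == j then v else f t.
Proof. by []. Qed.
Lemma upd_eq f j v : upd f j v j = v. Proof. by rewrite updE eqxx. Qed.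
Lemma upd_neq f j v t : t <> j -> upd f j v t = f t.
Proof. by move/eqP; rewrite updE => /negbTE->. Qed.

Lemma fasym_ext n f g : feq n f g -> fasym n f -> fasym n g.
Proof.
move=> e [hf hb].
have ltx s : permutes n s -> flt n f (f \o s) -> flt n g (g \o s).
  move=> ps [p [pn hp lp]]; exists p; split=> //= [t tp|].
    by rewrite -!e ?(permutes_lt ps) //; [exact: hp | lia..].
  by rewrite -!e ?(permutes_lt ps).
split=> i lt_in; last exact/ltx/hb/lt_in/permutes_bwd.
have ps := permutes_fwd lt_in.
case: (hf i lt_in) => [h|h]; [left; exact: ltx | right=> t tn /=].
by rewrite -!e ?(permutes_lt ps) //; exact: h.
Qed.

(** Reading $u^{j+1}v^{n-j-1}$ backwards from [j] gives the same word, so the strict comparison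
    fails there. *)
Lemma two_block_sym n f j u v : j < n -> (forall t, t <= j -> f t = u) ->
  (forall t, j < t < n -> f t = v) -> ~ fasym n f.
Proof.
move=> jn hu hv [_ /(_ j jn) [p [pn _ /=]]].
rewrite /bwd; case: (leqP p j) => pj; first by rewrite !hu; lia.
by rewrite !hv; lia.
Qed.

(* The only comparisons an increment at [j] can spoil are those decided at or after [j]
   by a reading that also meets the incremented symbol at or after [j]. *)
Lemma flt_upd_incr n f s j q v : permutes n s -> fle n f (f \o s) ->
  j < n -> q < n -> s q = j -> f j < v -> (forall t, j < t < n -> f t <> f j) ->
  [\/ flt n (upd f j v) (upd f j v \o s),
      feq n f (f \o s) /\ q = j |
      j <= q /\ exists p, [/\ j <= p < n, (forall t, t < p -> f t = f (s t)) & f p < f (s p)]].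
Proof.
move=> ps le_fs jn qn sq fv hj.
have sN t : t < n -> t <> q -> s t <> j.
  by move=> tn tq; rewrite -sq => /(permutes_inj ps tn qn).
case: le_fs => [[p [pn hp lp]]|e]; last first.
  (* If [q < j], the tie at [q] becomes strict, as the reading now shows [v] there; if [j < q], then
     [f q = f j], against [hj]. *)
  have [qj|jq|->] := ltngtP q j; last by constructor 2.
    constructor 1; exists q; split=> //= [t tq|].
      by rewrite !upd_neq; [apply: e|apply: sN|]; lia.
    by rewrite sq upd_eq upd_neq; [rewrite e //= sq|lia].
  by case: (hj q); rewrite ?jq // e //= sq.
have [pqj|jq] := boolP ((p < j) || (q < j)); last first.
  constructor 3; split; first by lia.
  by exists p; split=> //; lia.
(* [minn p q] lies before [j], so up to there only the reading can have changed, and only at [q],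
   where it grew. *)
constructor 1; exists (minn p q); split=> [|t tm|]; first by lia.
  by rewrite /= !upd_neq; [apply: hp|apply: sN|]; lia.
move: lp => /= lp; have [pq|qp|epq] := ltngtP p q.
- by rewrite /= !upd_neq; [|apply: sN|]; lia.
- by rewrite /= sq upd_eq upd_neq; [rewrite hp //= sq|lia].
subst q; rewrite sq in lp *.
by rewrite upd_eq upd_neq; lia.
Qed.

(** Together with [sum_permutes]: a rearrangement of a word that is termwise at most that word is
    equal to it. *)
Lemma eq_of_sum_le n (F G : nat -> nat) : (forall t, t < n -> F t <= G t) ->
  \sum_(0 <= t < n) F t = \sum_(0 <= t < n) G t -> feq n F G.
Proof.
elim: n => [//|n IH] le_FG; rewrite !big_nat_recr //= => e.
have le_s : \sum_(0 <= t < n) F t <= \sum_(0 <= t < n) G t.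
  by rewrite !big_mkord; apply: leq_sum => i _; apply: le_FG; case: i => i /=; lia.
have le_n := le_FG n (leqnn _).
move=> t; rewrite ltnS leq_eqVlt => /orP[/eqP->|tn]; first by lia.
by apply: IH tn; [move=> u un; apply: le_FG; lia|lia].
Qed.

Lemma sum_permutes n s (F : nat -> nat) : permutes n s ->
  \sum_(0 <= t < n) F (s t) = \sum_(0 <= t < n) F t.
Proof.
by move=> ps; rewrite /index_iota subn0 -(big_map s xpredT) (perm_big _ ps).
Qed.

(** * Incrementing the last non-maximal symbol *)

Section LastNonMax.
Variables (k n j : nat) (f : nat -> nat).
Hypotheses (hw : forall t, t < n -> f t < k) (hf : fasym n f) (jn : j < n).
Hypotheses (fj : f j < k - 1) (hj : forall t, j < t < n -> f t = k - 1).

Let g := upd f j (f j).+1.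

(** In the doubtful case of [flt_upd_incr] the comparison was decided at [j] itself, later symbols
    being maximal. If the increment turns this into a tie, then [g \o s] is termwise at most [g],
    hence equal to it, and reading [j] at [q > j] shows that the new symbol is maximal. *)
Lemma last_nonmax_step s : permutes n s -> fle n f (f \o s) ->
  flt n g (g \o s) \/ feq n g (g \o s) /\ (feq n f (f \o s) \/ (f j).+1 = k - 1).
Proof.
move=> ps le_fs; have [q qn sq] := permutes_surj ps jn.
have hj' t : j < t < n -> f t <> f j by move=> /hj ->; lia.
case: (flt_upd_incr ps le_fs jn qn sq (leqnn _) hj'); first by left.
  case=> e eq_qj; right; split; last by left.
  move=> t tn; rewrite /g /= !updE; have [->|/eqP tj] := eqVneq t j.
    by rewrite -{2}eq_qj sq eqxx.
  have /eqP/negbTE-> : s t <> j.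
    by rewrite -sq => /(permutes_inj ps tn qn); lia.
  exact: e.
case=> jq [p [pn hp lp]].
have ep : p = j.
  apply/eqP/negPn/negP=> /eqP pj; have := hw (permutes_lt ps (t := p) ltac:(lia)).
  by move: lp; rewrite (hj (t := p)); lia.
subst p; have jNq : j <> q by move=> e; move: lp; rewrite {2}e sq; lia.
have sj : s j <> j by move=> e; move: lp; rewrite e; lia.
have sN t : t < n -> t <> q -> s t <> j.
  by move=> tn tq; rewrite -sq => /(permutes_inj ps tn qn).
have gtj t : t < j -> g t = g (s t).
  by move=> tj; rewrite /g !upd_neq; [apply: hp|apply: sN|]; lia.
have gmax t : j < t < n -> g t = k - 1.
  by move=> tn; rewrite /g upd_neq; [apply: hj|]; lia.
have [lt_sj|le_sj] := ltnP (f j).+1 (f (s j)).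
  by left; exists j; split=> //; rewrite /g /= upd_eq upd_neq.
right; have gw t : t < n -> g t <= k - 1.
  move=> tn; rewrite /g updE; case: eqP => _; first by lia.
  by have := hw tn; lia.
have e : feq n (g \o s) g.
  apply: eq_of_sum_le; last exact: (sum_permutes g ps).
  move=> t tn /=; have [/gtj->//|jt|->] := ltngtP t j.
    by rewrite (gmax t) ?jt ?tn // gw // (permutes_lt ps).
  by rewrite /g upd_eq upd_neq; lia.
split; first by move=> t tn; rewrite e.
right; have := e q qn; rewrite (gmax q) /=; last by lia.
by rewrite sq /g upd_eq.
Qed.

Lemma last_nonmax_pos : 0 < j.
Proof.
case: (posnP j) => // j0; case: (@two_block_sym n f 0 (f 0) (k - 1)) => //; first by lia.
  by move=> t; rewrite leqn0 => /eqP->.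
by move=> t ht; apply: hj; lia.
Qed.

(* When incrementing the last non-maximal symbol produces a symmetric word,
   that word is a product of two palindromes, and the second one has to be a
   power of [k - 1]. *)
Lemma last_nonmax : fasym n g \/
  exists i, [/\ i < j, (forall t, t <= i -> f (i - t) = f t),
                (forall t, i < t < n -> t <> j -> f t = k - 1),
                f j = k - 2 & j + j < n + i].
Proof.
have [lefwd ltbwd] := hf.
have [/existsP[[i lt_in] /forallP e']|ne] :=
  boolP [exists i : 'I_n, [forall t : 'I_n, g t == g (bwd n i t)]]; last first.
  left; split=> i lt_in.
    case: (last_nonmax_step (permutes_fwd lt_in) (lefwd i lt_in)); first by left.
    by case=> e _; right.
  have [//|[e _]] := last_nonmax_step (permutes_bwd lt_in) (or_introl (ltbwd i lt_in)).
  case/existsP: ne; exists (Ordinal lt_in); apply/forallP=> t; apply/eqP; exact: e.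
have {}e : feq n g (g \o bwd n i) by move=> t tn; exact/eqP/(e' (Ordinal tn)).
(* The palindromes are [X], at positions [0] to [i], and [Y], at positions [i + 1] to [n - 1]. *)
right; exists i.
have [p [pn hp lp]] := ltbwd i lt_in.
have fjk : (f j).+1 = k - 1.
  case: (last_nonmax_step (permutes_bwd lt_in) (or_introl (ltbwd i lt_in))).
    by case=> r [rn _]; rewrite e //; lia.
  by case=> _ []// /(_ p pn); move: lp; lia.
have gmax t : j <= t < n -> g t = k - 1.
  move=> tn; rewrite /g updE; case: eqP => [_|tj]; first by lia.
  by apply: hj; lia.
have j0 := last_nonmax_pos.
have gf t : t <> j -> g t = f t by move=> ?; rewrite /g upd_neq.
have lt_ij : i < j.
  have := e i lt_in; rewrite /= /bwd leqnn subnn (gf 0); last by lia.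
  have f0 : f 0 <> k - 1.
    move=> f0; have := lefwd j jn; case=> [[r [rn hr lr]]|/(_ 0)]; last first.
      by rewrite /= /fwd addn0 jn; lia.
    move: hr lr; case: r rn => [|r] rn hr /=; first by rewrite /fwd addn0 jn; lia.
    by have := hr 0 isT; rewrite /= /fwd addn0 jn; lia.
  by move=> gi; case: (ltnP i j) => // ji; case: f0; rewrite -gi gmax ?ji.
have palX t : t <= i -> f (i - t) = f t.
  by move=> ti; rewrite -!gf; [rewrite [RHS]e /= /bwd ?ti //|..]; lia.
have palY t : i < t < n -> g (n + i - t) = g t.
  by move=> /andP[it tn]; rewrite [RHS]e //= /bwd leqNgt it.
(* [X] lies before [j], so it is a palindrome in [f] too and cannot decide the comparison. *)
have ip : i < p.
  by case: (ltnP i p) => // pi; move: lp; rewrite /= /bwd pi palX // ltnn.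
move: lp; rewrite /= /bwd (leqNgt p i) ip /= => lp.
(* [Y] is a palindrome in [g], so in [f] a symbol is below its mirror image only at [j], the
   position that lacks the increment. *)
have ep : p = j.
  apply/eqP/negPn/negP=> /eqP pj; have := palY p; rewrite ip pn => /(_ isT).
  rewrite (gf p pj); have [en|/eqP nj] := eqVneq (n + i - p) j.
    by rewrite en /g upd_eq; move: lp; rewrite en; lia.
  by rewrite gf //; lia.
subst p; have jj : j + j < n + i.
  have [//|jj|jj] := ltngtP (j + j) (n + i).
    have := hp (n + i - j); rewrite /= /bwd; case: (leqP (n + i - j) i); first by lia.
    by rewrite (_ : n + i - (n + i - j) = j); lia.
  by move: lp; rewrite (_ : n + i - j = j); lia.
split=> //; last by lia.
(* The mirror image [n + i - t] of a position between [i] and [j] lies beyond [j], where the symbols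
   are maximal. *)
move=> t it tj; have [tlj|] := ltnP t j; last by move=> ?; apply: hj; lia.
by rewrite -(gf t tj) -palY //; apply: gmax; lia.
Qed.
End LastNonMax.

(** * Decrementing the first nonzero symbol *)

(* Only a decrement of 1 to 0 could spoil a comparison, by lengthening a run of zeros
   to compete with the leading one; this cannot happen if [z = 0] or [1 < f z]. *)
Lemma first_nonmin n z f : fasym n f -> z < n -> (forall t, t < z -> f t = 0) ->
  0 < f z -> z = 0 \/ 1 < f z -> fasym n (upd f z (f z).-1).
Proof.
move=> [lefwd ltbwd] zn fz0 fz hz; set g := upd f z _.
have gN t : t <> z -> g t = f t by move=> ?; rewrite /g upd_neq.
have gz : g z = (f z).-1 by rewrite /g upd_eq.
have gle t : (f t).-1 <= g t by rewrite /g updE; case: eqP => [->|_]; lia.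
have step s : permutes n s -> flt n f (f \o s) -> flt n g (g \o s).
  move=> ps [p [pn /= hp lp]].
  have [q qn sq] := permutes_surj ps zn.
  have sN t : t < n -> t <> q -> s t <> z.
    by move=> tn tq; rewrite -sq => /(permutes_inj ps tn qn).
  (* Before [minn p z] the reading shows only zeros, so it cannot yet have met the nonzero symbol at
     [z]. *)
  have zq : (p < z -> p <= q) /\ (z <= p -> z <= q).
    split=> ?; rewrite leqNgt; apply/negP=> qp.
      by have := hp q qp; rewrite sq fz0; lia.
    have [qp'|] := ltnP q p; last by lia.
    by have := hp q qp'; rewrite sq fz0; lia.
  have eqz t : t < minn p z -> g t = g (s t).
    move=> ht; rewrite !gN; [apply: hp; lia| |lia].
    by apply: sN; lia.
  have [pz|zp|ez] := ltngtP p z.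
  - exists p; split=> //= [t tp|]; first by apply: eqz; lia.
    rewrite gN; last by lia.
    have [epq|/eqP npq] := eqVneq p q; last by rewrite gN //; exact: sN.
    (* Since [p < z] excludes [z = 0], we have [1 < f z], and the decremented symbol still beats the
       zero at [p]. *)
    by rewrite fz0 // epq sq gz; case: hz; lia.
  - have [ezq|/eqP nzq] := eqVneq z q.
      exists p; split=> //= [t tp|]; last by rewrite !gN //; [apply: sN|]; lia.
      have [->|/eqP tz] := eqVneq t z; first by rewrite {2}ezq sq.
      by rewrite !gN //; [apply: hp|apply: sN]; lia.
    exists z; split=> //= [t tz|]; first by apply: eqz; lia.
    by rewrite gz gN -?hp //; [lia|exact: sN].
  - subst p; exists z; split=> //= [t tz|]; first by apply: eqz; lia.
    by rewrite gz; have := gle (s z); lia.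
split=> i lt_in; last exact: step (permutes_bwd lt_in) (ltbwd i lt_in).
have ps := permutes_fwd lt_in.
case: (lefwd i lt_in) => [h|e]; first by left; exact: step.
have [q qn sq] := permutes_surj ps zn.
have sN t : t < n -> t <> q -> fwd n i t <> z.
  by move=> tn tq; rewrite -sq => /(permutes_inj ps tn qn).
have zq : z <= q.
  by rewrite leqNgt; apply/negP=> qz; have := e q qn; rewrite /= sq fz0; lia.
have [ezq|/eqP nzq] := eqVneq z q.
  right=> t tn /=; have [->|/eqP tz] := eqVneq t z; first by rewrite {2}ezq sq.
  by rewrite !gN //; [apply: e|apply: sN; lia].
left; exists z; split=> //= [t tz|].
  by rewrite !gN; [apply: e|apply: sN|]; lia.
by rewrite gz gN -?[f (fwd _ _ _)]e //; [lia|exact: sN].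
Qed.

(** * Replacing a final $k-1$ by 0 *)

(** The word $0a_1\cdots a_{n-1}$. When $a_n=k-1$ it is a rotation of $a_1\cdots a_{n-1}0$, whose
    necklace [LastSymbol] takes. *)
Definition shift0 (f : nat -> nat) (t : nat) : nat := if t is t'.+1 then f t' else 0.

(** The shifted word starts with [z + 1] zeros, a run found nowhere else in it. The only other
    reading starting with this run is the backward one from [z]; it continues with [f (n - 2)],
    which exceeds [f z]. *)
Lemma last_symbol n z f : fasym n f -> z.+2 < n -> (forall t, t < z -> f t = 0) ->
  0 < f z -> f z < f (n - 2) -> fasym n (shift0 f).
Proof.
move=> [lefwd ltbwd] zn fz0 fz lt_z; set g := shift0 f.
(* A window of [z + 1] zeros in [f] would start a rotation smaller than [f]. *)
have run j : j + z < n -> exists2 s, s <= z & 0 < f (j + s).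
  move=> jz; have jn : j < n by lia.
  have fE s : s <= z -> (f \o fwd n j) s = f (j + s).
    by move=> sz; rewrite /= /fwd; case: ltnP; lia.
  case: (lefwd j jn) => [[p [pn hp lp]]|e]; last first.
    by exists z => //; rewrite -fE // -e //; lia.
  have [pz|zp] := leqP p z; first by exists p; rewrite // -fE; lia.
  by exists z => //; rewrite -fE // -hp.
have g0 t : t <= z -> g t = 0 by case: t => //= t tz; exact: fz0.
have glast : g n.-1 = f (n - 2) by have -> : n.-1 = (n - 2).+1 by lia.
have win h s : s <= z -> 0 < h s -> flt n g h.
  elim/ltn_ind: s => s IH sz hs.
  have [/existsP[u hu]|hN] := boolP [exists u : 'I_s, 0 < h u].
    by apply: (IH u) => //; case: u {hu} => /=; lia.
  exists s; split=> [|t ts|]; [lia| |by rewrite g0].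
  rewrite g0; last by lia.
  by move/existsPn/(_ (Ordinal ts)): hN => /=; lia.
split=> i lt_in.
  case: (posnP i) => [->|i0]; first by right=> t tn; rewrite /= /fwd tn.
  left; have [iz|zi] := ltnP (i + z) n.
    have [|s sz fs] := run i.-1; first by lia.
    apply: (win _ s) => //=; rewrite /fwd (_ : i + s < n); last by lia.
    by have -> : i + s = (i.-1 + s).+1 by lia.
  apply: (win _ (n.-1 - i)) => /=; first by lia.
  rewrite /fwd (_ : i + (n.-1 - i) = n.-1); last by lia.
  by rewrite (_ : n.-1 < n) ?glast; lia.
have [iz|zi|->] := ltngtP i z.
- apply: (win _ i.+1) => //=; rewrite /bwd ltnn (_ : n + i - i.+1 = n.-1); last by lia.
  by rewrite glast; lia.
- have [|s sz fs] := run (i - z.+1); first by lia.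
  apply: (win _ (z - s)) => /=; first by lia.
  rewrite /bwd (_ : z - s <= i); last by lia.
  by have -> : i - (z - s) = (i - z.+1 + s).+1 by lia.
exists z.+1; split=> [|t tz|]; first by lia.
  by rewrite ltnS in tz; rewrite /= /bwd tz !g0 //; lia.
by rewrite /= /bwd ltnn (_ : n + z - z.+1 = n.-1) ?glast //; lia.
Qed.

(** * Incrementing the second-last non-maximal symbol *)

(** The word ends in 012. By [flt_upd_incr] only readings that meet [n - 3] at one of the last three
    places matter. The nontrivial forward ones start with 1 or 2, above [f 0]; the backward ones are
    checked one by one. *)
Lemma second_last_nonmax n f : fasym n f -> 5 <= n -> f 0 = 0 ->
  f (n - 4) <> 2 -> f (n - 3) = 0 -> f (n - 2) = 1 -> f (n - 1) = 2 ->
  fasym n (upd f (n - 3) 1).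
Proof.
move=> [lefwd ltbwd] n5 f0 f4 f3 f2 f1; set j := n - 3; set g := upd f j 1.
have jn : j < n by lia.
have fj : f j < 1 by rewrite f3.
have hj t : j < t < n -> f t <> f j.
  move=> ht; have [->|->] : t = n - 2 \/ t = n - 1 by lia.
    by rewrite f2 f3.
  by rewrite f1 f3.
split=> i lt_in.
  have ps := permutes_fwd lt_in; have [q qn sq] := permutes_surj ps jn.
  case: (posnP i) => [->|i0]; first by right=> t tn; rewrite /= /fwd tn.
  case: (flt_upd_incr ps (lefwd i lt_in) jn qn sq fj hj); first by left.
    by case=> _ eqj; move: sq; rewrite eqj /fwd; case: ifP; lia.
  case=> jq [p [pn hp _]]; have := hp 0; rewrite /fwd addn0 lt_in f0.
  have [->|->] : i = n - 2 \/ i = n - 1 by move: sq; rewrite /fwd; case: ifP; lia.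
    by rewrite f2; lia.
  by rewrite f1; lia.
have ps := permutes_bwd lt_in; have [q qn sq] := permutes_surj ps jn.
case: (flt_upd_incr ps (or_introl (ltbwd i lt_in)) jn qn sq fj hj); first by [].
  case=> e _; case: (ltbwd i lt_in) => p [pn _ lp].
  by have := e p pn; lia.
case=> jq [p [pn hp lp]].
(* A backward reading is a reflection: a position and its image have constant sum modulo [n], here
   that of [q] and [j]. *)
have bE t u : t < n -> u < n -> t + u = q + j \/ t + u + n = q + j -> bwd n i t = u.
  by move: sq; rewrite /bwd; case: ifP; case: ifP; lia.
have [eq|[eq|eq]] : q = n - 3 \/ q = n - 2 \/ q = n - 1 by lia.
- have b4 : bwd n i (n - 4) = n - 2 by apply: bE; lia.
  have b5 : bwd n i (n - 5) = n - 1 by apply: bE; lia.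
  have b3 : bwd n i (n - 3) = n - 3 by apply: bE; lia.
  have b2 : bwd n i (n - 2) = n - 4 by apply: bE; lia.
  have b1 : bwd n i (n - 1) = n - 5 by apply: bE; lia.
  have h4 := hp (n - 4); have h5 := hp (n - 5); rewrite b4 f2 in h4; rewrite b5 f1 in h5.
  have [ep|[ep|ep]] : p = n - 3 \/ p = n - 2 \/ p = n - 1 by lia.
  + by move: lp; rewrite ep b3; lia.
  + by move: lp; rewrite ep b2; lia.
  + by move: lp; rewrite ep b1; lia.
- have b4 : bwd n i (n - 4) = n - 1 by apply: bE; lia.
  by case: f4; rewrite hp ?b4 //; lia.
have b3 : bwd n i (n - 3) = n - 1 by apply: bE; lia.
exists j; split=> // [t tj|] /=.
  by rewrite /g !upd_neq; [apply: hp| |]; try lia; rewrite -sq => /(permutes_inj ps); lia.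
by rewrite /j b3 /g upd_eq upd_neq ?f1 //; lia.
Qed.

(** * Lists: lexicographic order, rotations, necklaces *)

Lemma lexle_refl : reflexive lexle.
Proof. by elim=> //= x s ->; rewrite eqxx orbT. Qed.

Lemma lexle_trans : transitive lexle.
Proof.
move=> b a; elim: a b => // x a IH [|y b] [|u c] //=.
case/orP=> [xy|/andP[/eqP-> ab]]; case/orP=> [yu|/andP[/eqP e bc]]; subst.
- by rewrite (ltn_trans xy yu).
- by rewrite xy.
- by rewrite yu.
- by rewrite eqxx (IH b c) ?orbT.
Qed.

Lemma lexle_anti : antisymmetric lexle.
Proof.
elim=> [|x a IH] [|y b] //=; case: (ltngtP x y) => //= ->.
by move/IH->.
Qed.

Lemma lexle_total : total lexle.
Proof. by elim=> [|x a IH] [|y b] //=; case: (ltngtP x y) => //=. Qed.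

Lemma lexleP n a b : size a = n -> size b = n ->
  lexle a b <-> fle n (nth 0 a) (nth 0 b).
Proof.
elim: a b n => [|x a IH] [|y b] [|n] //=; first by move=> _ _; split=> // _; right.
case=> sa [sb]; have {IH} := IH b n sa sb; case: (ltngtP x y) => /= [lt|lt|->] IH.
- by split=> // _; left; exists 0.
- split=> //; case=> [[[|p] [_ + /=]]|/(_ 0 isT) /=]; [by lia| |by lia].
  by move=> /(_ 0 isT) /=; lia.
split=> [/IH[[p [pn hp lp]]|e]|[[[|p] [pn hp lp]]|e]].
- by left; exists p.+1; split=> // -[|t] //= tp; exact: hp.
- by right=> -[|t] //= tn; exact: e.
- by move: lp; rewrite ltnn.
- by apply/IH; left; exists p; split=> // t tp; exact: (hp t.+1).
- by apply/IH; right=> t tn; exact: (e t.+1).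
Qed.

Lemma nth_rot_fwd n a i t : size a = n -> i < n -> t < n ->
  nth 0 (rot i a) t = nth 0 a (fwd n i t).
Proof.
move=> sa lt_in tn; rewrite /rot /fwd nth_cat size_drop sa nth_drop ltn_subRL.
case: ltnP => // ?; rewrite nth_take; last by lia.
by congr nth; lia.
Qed.

Lemma nth_rot_rev_bwd n a i t : size a = n -> i < n -> t < n ->
  nth 0 (rot i (rev a)) t = nth 0 a (bwd n (n.-1 - i) t).
Proof.
move=> sa lt_in tn; rewrite (@nth_rot_fwd n) ?size_rev // nth_rev sa; last first.
  by rewrite /fwd; case: ifP; lia.
by congr nth; rewrite /fwd /bwd; case: ifP; case: ifP; lia.
Qed.

Lemma mem_rotations (a b : seq nat) :
  reflect (exists2 i, i < size a & b = rot i a) (b \in rotations a).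
Proof.
apply: (iffP mapP) => -[i]; first by rewrite mem_iota => lt_i ->; exists i.
by move=> lt_i ->; exists i; rewrite ?mem_iota.
Qed.

Lemma rot_sym (a b : seq nat) i : i < size a -> b = rot i a -> exists2 j, j < size b & a = rot j b.
Proof.
move=> lt_i ->; case: (posnP i) => [->|i0]; first by exists 0; rewrite ?rot0 ?size_rot //; lia.
exists (size a - i); first by rewrite size_rot; lia.
by rewrite -{1}(rotK i a) /rotr size_rot.
Qed.

Lemma flt_ext n f g h : feq n g h -> flt n f g -> flt n f h.
Proof.
move=> e [p [pn hp lp]]; exists p; split=> // [t tp|]; last by rewrite -e.
by rewrite hp // e //; lia.
Qed.

Lemma fle_ext n f g h : feq n g h -> fle n f g -> fle n f h.
Proof.
move=> e [/(flt_ext e)|e']; first by left.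
by right=> t tn; rewrite e' // e.
Qed.

(** A tie with a rotation of the reversal would make [rev a] a rotation of [a], so asymmetry turns
    the weak comparison into a strict one, and conversely. *)
Lemma asymP k n a : asym_bracelet k n a <->
  [/\ size a = n, forall t, t < n -> nth 0 a t < k & fasym n (nth 0 a)].
Proof.
have fwdE i : size a = n -> i < n -> feq n (nth 0 (rot i a)) (nth 0 a \o fwd n i).
  by move=> sa lt_in t tn; rewrite (nth_rot_fwd sa).
have bwdE i : size a = n -> i < n ->
    feq n (nth 0 (rot i (rev a))) (nth 0 a \o bwd n (n.-1 - i)).
  by move=> sa lt_in t tn; rewrite (nth_rot_rev_bwd sa).
have feqC f g : feq n f g -> feq n g f by move=> e t tn; rewrite e.
split.
  case/and3P=> /andP[/eqP sa /allP ak] br ns.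
  move: br; rewrite /is_bracelet all_cat => /andP[/allP nk /allP br].
  move: ns; rewrite /symmetric_necklace {1}/is_necklace (introT allP nk) /= => ns.
  split=> // [t tn|]; first by apply: ak; rewrite mem_nth ?sa.
  split=> i lt_in.
    apply: fle_ext (fwdE i sa lt_in) _; apply/lexleP; rewrite ?size_rot //.
    by apply: nk; apply/mem_rotations; exists i; rewrite ?sa.
  have lt_i' : n.-1 - i < n by lia.
  have := bwdE (n.-1 - i) sa lt_i'; rewrite (_ : n.-1 - (n.-1 - i) = i); last by lia.
  move=> eb; have : lexle a (rot (n.-1 - i) (rev a)).
    by apply: br; apply/mem_rotations; exists (n.-1 - i); rewrite ?size_rev ?sa.
  rewrite (lexleP (n := n)) ?size_rot ?size_rev // => -[/(flt_ext eb)//|e].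
  have {}e : a = rot (n.-1 - i) (rev a).
    by apply: (@eq_from_nth _ 0); rewrite ?size_rot ?size_rev ?sa.
  case/mem_rotations: ns.
  by apply: rot_sym e; rewrite size_rev sa.
case=> sa ak [lefwd ltbwd]; apply/and3P; split.
- by rewrite /is_word sa eqxx; apply/(all_nthP 0) => t; rewrite sa; exact: ak.
- rewrite /is_bracelet all_cat; apply/andP; split; apply/allP=> _ /mem_rotations[i + ->].
    rewrite sa => lt_in; apply/(lexleP (n := n)); rewrite ?size_rot //.
    exact: fle_ext (feqC _ _ (fwdE i sa lt_in)) (lefwd i lt_in).
  rewrite size_rev sa => lt_in; apply/(lexleP (n := n)); rewrite ?size_rot ?size_rev //.
  apply: fle_ext (feqC _ _ (bwdE i sa lt_in)) _; left; apply: ltbwd; lia.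
rewrite /symmetric_necklace negb_and; apply/orP; right; apply/negP=> /mem_rotations[i lt_i e].
have [j lt_j ea] := rot_sym lt_i e; rewrite size_rev sa in lt_j.
have [|p [pn _ lp]] := ltbwd (n.-1 - j); first by lia.
by move: lp; rewrite -(bwdE j sa lt_j p pn) -ea ltnn.
Qed.

Lemma asym_set_nth k n a j v : asym_bracelet k n a -> j < n -> v < k ->
  fasym n (upd (nth 0 a) j v) -> asym_bracelet k n (set_nth 0 a j v).
Proof.
case/asymP=> sa ak _ jn vk hf; apply/asymP; split.
- by rewrite size_set_nth sa; lia.
- by move=> t tn; rewrite nth_set_nth /=; case: eqP => // _; exact: ak.
by apply: fasym_ext hf => t tn; rewrite nth_set_nth.
Qed.

Lemma neck_in s : neck s \in s :: rotations s.
Proof.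
rewrite /neck; elim: (rotations s) => [|x r IH] /=; first by rewrite inE.
case: ifP => _; first by rewrite !inE eqxx orbT.
by move: IH; rewrite !inE => /orP[->|->]; rewrite ?orbT.
Qed.

Lemma neck_rot s : exists2 j, j <= size s & neck s = rot j s.
Proof.
have := neck_in s; rewrite inE => /orP[/eqP->|/mem_rotations[j ? ->]].
  by exists 0; rewrite ?rot0.
by exists j => //; exact: ltnW.
Qed.

Lemma neck_min s i : i < size s -> lexle (neck s) (rot i s).
Proof.
move=> lt_i; have : rot i s \in rotations s by apply/mem_rotations; exists i.
rewrite /neck; elim: (rotations s) => [|x r IH] //=; rewrite inE.
case: ifP => lex => /orP[/eqP->|/IH h]; rewrite ?lexle_refl //.
  exact: lexle_trans h.
by have := lexle_total x (foldr (fun t m => if lexle t m then t else m) s r); rewrite lex.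
Qed.

Lemma rot_in_rotations (s : seq nat) j : 0 < size s -> j <= size s -> rot j s \in rotations s.
Proof.
move=> s0; rewrite leq_eqVlt => /orP[/eqP->|?]; apply/mem_rotations; last by exists j.
by exists 0; rewrite ?rot_size ?rot0.
Qed.

Lemma neck_unique s i : i < size s -> is_necklace (rot i s) -> neck s = rot i s.
Proof.
move=> lt_i /allP nk; apply: lexle_anti; rewrite neck_min //=; apply: nk.
have [j le_j ->] := neck_rot s.
have [m m_lt e] := rot_sym lt_i (erefl (rot i s)); rewrite size_rot in m_lt.
rewrite {1}e rot_add_mod ?size_rot; try lia.
by apply: rot_in_rotations; rewrite ?size_rot; [|case: ifP]; lia.
Qed.

(** * The operations as changes of a single symbol *)

Lemma last_filter_iota (P : pred nat) n : has P (iota 0 n) ->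
  let j := last 0 (filter P (iota 0 n)) in
  [/\ j < n, P j & forall t, j < t < n -> ~~ P t].
Proof.
elim: n => // n IH; rewrite -addn1 iotaD add0n /= has_cat /= orbF filter_cat /= last_cat.
case: ifP => Pn; first by move=> _; split=> //= [|t]; lia.
rewrite orbF /= => /IH[jn Pj h]; split=> // [|t tj]; first by lia.
have [->|/eqP tn] := eqVneq t n; first by rewrite Pn.
by apply: h; lia.
Qed.

(** With [u = k - 1] and [u = 0] this supplies the indices sought by [LastNonMax] and
    [FirstNonMin]. *)
Lemma asym_not_const k n a u : 0 < n -> asym_bracelet k n a ->
  exists2 t, t < n & nth 0 a t != u.
Proof.
move=> n0 /asymP[sa _ hf].
have [/existsP[t h]|/existsPn h] := boolP [exists t : 'I_n, nth 0 a t != u]; first by exists t.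
have e t : t < n -> nth 0 a t = u by move=> tn; have := h (Ordinal tn); rewrite negbK => /eqP.
by case: (@two_block_sym n (nth 0 a) 0 u u n0) => // t ht; apply: e; lia.
Qed.

Lemma LastNonMaxE k n a : 0 < n -> asym_bracelet k n a ->
  exists j, [/\ j < n, nth 0 a j <> k - 1, forall t, j < t < n -> nth 0 a t = k - 1
              & LastNonMax k a = set_nth 0 a j (nth 0 a j).+1].
Proof.
move=> n0 asym_a; have [sa _ _] := (asymP k n a).1 asym_a.
have [t tn ht] := asym_not_const (k - 1) n0 asym_a.
set P := fun i => nth 0 a i != k - 1.
have hP : has P (iota 0 n) by apply/hasP; exists t; rewrite ?mem_iota.
have [jn /eqP Pj h] := last_filter_iota hP.
rewrite /LastNonMax /nonmax_idx sa -/P; move: hP jn Pj h; rewrite has_filter.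
case: (filter P _) => // i0 idx _; set j := last _ _ => jn Pj h; exists j; split=> //.
  by move=> u hu; have := h u hu; rewrite negbK => /eqP.
rewrite set_nthE sa jn; congr (_ ++ _ :: _).
apply: (@eq_from_nth _ 0); first by rewrite size_nseq size_drop sa.
move=> u; rewrite size_nseq => hu; rewrite nth_nseq hu nth_drop.
by have := h (j.+1 + u); rewrite negbK => /(_ ltac:(lia)) /eqP->.
Qed.

Definition leading_zeros (a : seq nat) : nat := find (fun x => x != 0) a.

Lemma leading_zerosP k n a : 0 < n -> asym_bracelet k n a ->
  let z := leading_zeros a in
  [/\ z < n, 0 < nth 0 a z & forall t, t < z -> nth 0 a t = 0].
Proof.
move=> n0 asym_a; have [sa _ _] := (asymP k n a).1 asym_a.
have [t tn ht] := asym_not_const 0 n0 asym_a.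
have h : has (fun x => x != 0) a by apply/(has_nthP 0); exists t; rewrite ?sa.
split; first by rewrite -sa -has_find.
  by have := nth_find 0 h; rewrite lt0n.
by move=> u /(before_find 0) /negbFE/eqP.
Qed.

Lemma leading_zeros_eq a z : z < size a -> 0 < nth 0 a z ->
  (forall t, t < z -> nth 0 a t = 0) -> leading_zeros a = z.
Proof.
move=> za nz h; have ha : has (fun x => x != 0) a by apply/(has_nthP 0); exists z => //; lia.
have [lt|lt|//] := ltngtP (leading_zeros a) z.
  by have /= := nth_find 0 ha; rewrite [nth _ _ _]h.
by have := before_find 0 lt; move: nz; lia.
Qed.

Lemma leading_zeros_ge a m : m <= size a -> (forall t, t < m -> nth 0 a t = 0) ->
  m <= leading_zeros a.
Proof.
move=> ma h; rewrite leqNgt; apply/negP=> lt.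
have ha : has (fun x => x != 0) a by rewrite has_find; exact: leq_trans lt ma.
by have /= := nth_find 0 ha; rewrite [nth _ _ _]h.
Qed.

Lemma FirstNonMinE a : leading_zeros a < size a ->
  FirstNonMin a = set_nth 0 a (leading_zeros a) (nth 0 a (leading_zeros a)).-1.
Proof.
by move=> za; rewrite /FirstNonMin -/(leading_zeros a) set_nthE za; case: eqP => // e; lia.
Qed.

Lemma LastSymbolE k a : 0 < k -> 0 < size a -> nth 0 a (size a - 1) = k - 1 ->
  LastSymbol k a = neck (set_nth 0 a (size a - 1) 0).
Proof.
move=> k0 a0; rewrite subn1 nth_last => e; rewrite /LastSymbol e.
rewrite (_ : (k - 1).+1 = k) ?modnn; last by lia.
rewrite set_nthE subn1 (_ : (size a).-1 < size a); last by lia.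
by rewrite (_ : (size a).-1.+1 = size a) ?drop_size ?cats1; last by lia.
Qed.

Lemma LastSymbol_shift k n a : 0 < k -> 0 < n -> size a = n -> nth 0 a (n - 1) = k - 1 ->
  (forall t, t < n -> nth 0 a t < k) -> fasym n (shift0 (nth 0 a)) ->
  asym_bracelet k n (LastSymbol k a).
Proof.
move=> k0 n0 sa ek ak hf; rewrite LastSymbolE ?sa //; set s := set_nth _ _ _ _.
have ss : size s = n by rewrite size_set_nth sa; lia.
have nE t : t < n -> nth 0 (rot (n - 1) s) t = shift0 (nth 0 a) t.
  move=> tn; rewrite (nth_rot_fwd ss) ?nth_set_nth //=; last by lia.
  case: t tn => [|t] tn; first by rewrite (_ : fwd _ _ _ = n - 1) ?eqxx // /fwd; case: ifP; lia.
  by rewrite (_ : fwd _ _ _ = t) 1?ifF //=; [|rewrite /fwd; case: ifP]; lia.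
have as_r : asym_bracelet k n (rot (n - 1) s).
  apply/asymP; split; rewrite ?size_rot //.
    by move=> [|t] tn; rewrite nE //=; apply: ak; lia.
  by apply: fasym_ext hf => t tn; rewrite nE.
rewrite (neck_unique (i := n - 1)) ?ss //; first by lia.
by case/and3P: as_r => _ + _; rewrite /is_bracelet all_cat => /andP[].
Qed.

(** The rotation starting at the new final 0 has one more leading zero than [a], and the necklace is
    no larger than it. *)
Lemma LastSymbol_leading_zeros k n a : 0 < k -> 0 < n -> asym_bracelet k n a ->
  nth 0 a (n - 1) = k - 1 -> leading_zeros a < n - 1 ->
  leading_zeros a < leading_zeros (LastSymbol k a).
Proof.
move=> k0 n0 asym_a ek zn; have [_ _ fz0] := leading_zerosP n0 asym_a.
have [sa _ _] := (asymP k n a).1 asym_a.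
rewrite LastSymbolE ?sa //; set s := set_nth _ _ _ _.
have ss : size s = n by rewrite size_set_nth sa; lia.
have rz t : t <= leading_zeros a -> nth 0 (rot (n - 1) s) t = 0.
  move=> tz; rewrite (nth_rot_fwd ss) ?nth_set_nth //=; try lia.
  case: t tz => [|t] tn; first by rewrite (_ : fwd _ _ _ = n - 1) ?eqxx // /fwd; case: ifP; lia.
  by rewrite (_ : fwd _ _ _ = t) 1?ifF ?fz0 //=; [|rewrite /fwd; case: ifP]; lia.
have lt_s : n - 1 < size s by lia.
have := neck_min lt_s; have [j le_j ->] := neck_rot s.
rewrite (lexleP (n := n)) ?size_rot // => le_r.
apply: leading_zeros_ge => [|t tz]; first by rewrite size_rot ss; lia.
case: le_r => [[p [pn hp lp]]|e]; last by rewrite e ?rz //; lia.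
have [tp|pt] := ltnP t p; first by rewrite hp ?rz.
by move: lp; rewrite rz; lia.
Qed.

(** * The measure improved by each step *)

(* Words [0^z x (k-1)^m] get weight 0 because there LastNonMax increments the first nonzero symbol. *)
Definition head_weight (k : nat) (a : seq nat) : nat :=
  if all (pred1 (k - 1)) (drop (leading_zeros a).+1 a) then 0
  else nth 0 a (leading_zeros a).

Definition closer (k : nat) (a b : seq nat) : Prop :=
  leading_zeros a < leading_zeros b \/ leading_zeros b = leading_zeros a /\
  (head_weight k b < head_weight k a \/
   head_weight k b <= head_weight k a /\ sumn a < sumn b).

Lemma head_weight_max k a : (forall t, leading_zeros a < t < size a -> nth 0 a t = k - 1) ->
  head_weight k a = 0.
Proof.
move=> h; rewrite /head_weight ifT //; apply/(all_nthP 0) => t.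
by rewrite size_drop => ht; rewrite nth_drop /= h ?eqxx //; lia.
Qed.

Lemma head_weight_nonmax k a t : leading_zeros a < t < size a -> nth 0 a t <> k - 1 ->
  head_weight k a = nth 0 a (leading_zeros a).
Proof.
move=> ht ne; rewrite /head_weight ifF //; apply/negP=> /(all_nthP 0) h; case: ne.
have := h (t - (leading_zeros a).+1); rewrite size_drop nth_drop /=.
rewrite (_ : (leading_zeros a).+1 + _ = t); last by lia.
by move=> h'; apply/eqP/h'; lia.
Qed.

Lemma head_weight_le k a : head_weight k a <= nth 0 a (leading_zeros a).
Proof. by rewrite /head_weight; case: ifP. Qed.

Lemma sumn_incr a i v : i < size a -> nth 0 a i < v -> sumn a < sumn (set_nth 0 a i v).
Proof.
move=> ia lt; rewrite sumn_set_nth ia muln1.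
by have := sumn_set_nth a 0 i 0; rewrite ia muln1; lia.
Qed.

(** An increment after the first nonzero symbol keeps that symbol, which is the full weight of [a]
    because [i] is non-maximal; the weight cannot grow, and the sum does. *)
Lemma closer_incr k a i v : 0 < nth 0 a (leading_zeros a) ->
  (forall t, t < leading_zeros a -> nth 0 a t = 0) ->
  leading_zeros a < i < size a -> nth 0 a i <> k - 1 -> nth 0 a i < v ->
  closer k a (set_nth 0 a i v).
Proof.
move=> fz fz0 hi ne lt; set b := set_nth _ _ _ _.
have sb : size b = size a by rewrite size_set_nth; lia.
have bN t : t <> i -> nth 0 b t = nth 0 a t.
  by move=> ti; rewrite nth_set_nth /=; case: eqP.
have zb : leading_zeros b = leading_zeros a.
  apply: leading_zeros_eq => [||t tz]; [lia| |].
    by rewrite bN //; lia.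
  by rewrite bN ?fz0 //; lia.
right; split=> //; right; split; last by apply: sumn_incr; lia.
rewrite (head_weight_nonmax hi ne); apply: leq_trans (head_weight_le _ _) _.
by rewrite zb bN //; lia.
Qed.

(** * The root *)

Lemma rnkE n k a : 2 <= n -> size a = n -> (forall t, t < n - 2 -> nth 0 a t = 0) ->
  nth 0 a (n - 2) = k - 2 -> nth 0 a (n - 1) = k - 1 -> a = rnk n k.
Proof.
move=> n2 sa h0 h2 h1; apply: (@eq_from_nth _ 0).
  by rewrite size_cat size_nseq sa /=; lia.
move=> t; rewrite sa => tn; rewrite nth_cat size_nseq; case: ltnP => lt.
  by rewrite nth_nseq lt h0.
have [->|->] : t = n - 2 \/ t = n - 1 by lia.
  by rewrite subnn h2.
by rewrite (_ : n - 1 - (n - 2) = 1) ?h1 //; lia.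
Qed.

Lemma fasym_root n k f : 3 <= n -> 3 <= k -> (forall t, t < n - 2 -> f t = 0) ->
  f (n - 2) = k - 2 -> f (n - 1) = k - 1 -> fasym n f.
Proof.
move=> n3 k3 f0 f2 f1; split=> i lt_in.
  case: (posnP i) => [->|i0]; first by right=> t tn; rewrite /= /fwd tn.
  left; have [->|/eqP ni] := eqVneq i (n - 1).
    exists 0; split=> //=; first by lia.
    have -> : fwd n (n - 1) 0 = n - 1 by rewrite /fwd; case: ifP; lia.
    by rewrite f1 f0; lia.
  exists (n - 2 - i); split=> [|t lt|] /=; first by lia.
    rewrite !f0 //; last by lia.
    by rewrite /fwd; case: ifP; lia.
  have -> : fwd n i (n - 2 - i) = n - 2 by rewrite /fwd; case: ifP; lia.
  by rewrite f2 f0; lia.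
have [lt|[->|->]] : i < n - 2 \/ i = n - 2 \/ i = n - 1 by lia.
- exists i.+1; split=> [|t ti|] /=; first by lia.
    rewrite !f0 //; last by lia.
    by rewrite /bwd; case: ifP; lia.
  have -> : bwd n i i.+1 = n - 1 by rewrite /bwd; case: ifP; lia.
  (* The backward reading from [n - 3] ties on all the leading zeros; then $k-2<k-1$ decides. *)
  rewrite f1; have [->|/eqP ne] := eqVneq i.+1 (n - 2); first by rewrite f2; lia.
  by rewrite f0; lia.
- exists 0; split=> //=; first by lia.
  by rewrite /bwd leq0n subn0 f2 f0; lia.
- exists 0; split=> //=; first by lia.
  by rewrite /bwd leq0n subn0 f1 f0; lia.
Qed.

Lemma asym_rnk n k : 3 <= n -> 3 <= k -> asym_bracelet k n (rnk n k).
Proof.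
move=> n3 k3.
have f0 t : t < n - 2 -> nth 0 (rnk n k) t = 0.
  by move=> lt; rewrite nth_cat size_nseq lt nth_nseq lt.
have f2 : nth 0 (rnk n k) (n - 2) = k - 2 by rewrite nth_cat size_nseq ltnn subnn.
have f1 : nth 0 (rnk n k) (n - 1) = k - 1.
  rewrite nth_cat size_nseq ifF; last by lia.
  by rewrite (_ : n - 1 - (n - 2) = 1) //; lia.
apply/asymP; split; first by rewrite size_cat size_nseq /=; lia.
  move=> t tn; have [lt|[->|->]] : t < n - 2 \/ t = n - 2 \/ t = n - 1 by lia.
  - by rewrite f0; lia.
  - by rewrite f2; lia.
  - by rewrite f1; lia.
exact: fasym_root f1.
Qed.

(** * One step of the parent map *)

Definition one_change (n : nat) (a b : seq nat) : Prop :=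
  exists i v j, [/\ i < n, v <> nth 0 a i, j <= n & b = rot j (set_nth 0 a i v)].

Lemma one_change_set_nth n a i v : i < n -> v <> nth 0 a i ->
  one_change n a (set_nth 0 a i v).
Proof. by move=> lt_in ne; exists i, v, 0; rewrite rot0. Qed.

(** Both words are rotated so that the changed position comes first. *)
Lemma one_change_heads n a b : size a = n -> one_change n a b ->
  exists i j, head 0 (rot i a) != head 0 (rot j b) /\ behead (rot i a) = behead (rot j b).
Proof.
move=> sa [i [v [j [lt_in /eqP ne le_jn ->]]]]; set s := set_nth 0 a i v.
have ss : size s = n by rewrite size_set_nth sa; lia.
have [m em] : exists m, rot m (rot j s) = rot i s.
  have e : s = rot (n - j) (rot j s) by rewrite -{1}(rotK j s) /rotr size_rot ss.
  have -> : rot i s = rot i (rot (n - j) (rot j s)) by rewrite -e.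
  by rewrite rot_add_mod ?size_rot ?ss; [eexists|lia..].
exists i, m; rewrite em.
have rE c : i < size c -> rot i c = nth 0 c i :: drop i.+1 c ++ take i c.
  by move=> ic; rewrite /rot (drop_nth 0).
rewrite !rE ?sa ?ss //= nth_set_nth /= eqxx eq_sym; split=> //.
rewrite /s set_nthE sa lt_in take_size_cat ?drop_cat ?size_take ?sa ?lt_in //.
by rewrite ltnNge leqnSn subSnn /= drop0.
Qed.

Lemma Par_step n k a : 3 <= n -> 3 <= k -> asym_bracelet k n a -> a <> rnk n k ->
  [/\ asym_bracelet k n (Par k n a), closer k a (Par k n a) & one_change n a (Par k n a)].
Proof.
move=> n3 k3 asym_a ne_a; have n0 : 0 < n by lia.
have [sa ak hf] := (asymP k n a).1 asym_a.
have [zn fz fz0] := leading_zerosP n0 asym_a.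
have [j [jn fjN hj eL]] := LastNonMaxE n0 asym_a.
set z := leading_zeros a in zn fz fz0; set f := nth 0 a in ak hf fz fz0 fjN hj eL.
have fj : f j < k - 1 by have := ak j jn; lia.
have zj : z <= j.
  rewrite leqNgt; apply/negP=> jz; apply: (@two_block_sym n f j 0 (k - 1) jn _ _ hf) => // t tj.
  by apply: fz0; lia.
have cL : closer k a (LastNonMax k a).
  rewrite eL; have [ezj|/eqP nzj] := eqVneq z j; last first.
    by apply: closer_incr => //; rewrite ?sa; lia.
  set b := set_nth _ _ _ _.
  have sb : size b = n by rewrite size_set_nth sa; lia.
  have bE t : nth 0 b t = if t == j then (f j).+1 else f t by rewrite nth_set_nth.
  have zb : leading_zeros b = z.
    apply: leading_zeros_eq => [||t tz]; rewrite ?sb // bE; first by rewrite ezj eqxx.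
    by rewrite ifF ?fz0 //; lia.
  right; split=> //; right; split; last by apply: sumn_incr; rewrite ?sa.
  rewrite head_weight_max // zb sb ezj => t tz.
  by rewrite bE ifF ?hj //; lia.
rewrite /Par /candidates /=; case: ifP => aL.
  by split=> //; rewrite eL; apply: one_change_set_nth => //; rewrite -/f; lia.
have [hL|[i [lt_ij pal imax fj2 jj]]] := last_nonmax ak hf jn fj hj.
  move: aL; rewrite eL => /negP[]; apply: asym_set_nth => //; lia.
have fn1 : f (n - 1) = k - 1 by apply: hj; lia.
case: ifP => aS.
  split=> //=.
    by left; apply: (@LastSymbol_leading_zeros k n) => //; rewrite -/z; lia.
  rewrite LastSymbolE ?sa //; last by lia.
  set s := set_nth _ _ _ _; have [m le_m ->] := neck_rot s.
  have ss : size s = n by rewrite size_set_nth sa; lia.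
  exists (n - 1), 0, m; split=> //; try lia.
  by rewrite -/f fn1; lia.
have jN : z = j -> z <> n - 2.
  move=> ezj ez; apply/ne_a/rnkE; rewrite ?sa //; first by lia.
    by move=> t tn; apply: fz0; lia.
  by rewrite -ez ezj.
(* What the failure of [LastSymbol] means, by [last_symbol]. *)
have fS : z < n - 2 -> f (n - 2) <= f z.
  move=> lt_z; rewrite leqNgt; apply/negP=> ltf; move/negP: aS; case.
  by apply: LastSymbol_shift => //; try lia; apply: (last_symbol (z := z)) => //; lia.
have nzj : z < j.
  rewrite ltn_neqAle zj andbT; apply/eqP=> ezj; have := jN ezj => ?.
  have := fS ltac:(lia); rewrite hj; last by lia.
  by rewrite ezj; lia.
have eF : FirstNonMin a = set_nth 0 a z (f z).-1 by rewrite FirstNonMinE ?sa.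
case: ifP => aF.
  split=> //=; last by rewrite eF; apply: one_change_set_nth => //; rewrite -/f; lia.
  rewrite eF; set b := set_nth _ _ _ _.
  have sb : size b = n by rewrite size_set_nth sa; lia.
  have bE t : nth 0 b t = if t == z then (f z).-1 else f t by rewrite nth_set_nth.
  (* Decrementing 1 creates a new leading zero; otherwise the weight drops, [j > z] being
     non-maximal. *)
  have [fz1|] := leqP (f z) 1.
    left; apply: leading_zeros_ge => [|t]; rewrite ?sb // ltnS leq_eqVlt -/z bE.
    by case: eqP => [_ _|_ /fz0//]; lia.
  move=> fz1; have zb : leading_zeros b = z.
    apply: leading_zeros_eq => [||t tz]; rewrite ?sb // bE; first by rewrite eqxx; lia.
    by rewrite ifF ?fz0 //; lia.
  right; split=> //; left; rewrite (@head_weight_nonmax k a j) ?sa //; last by rewrite nzj.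
  by apply: leq_ltn_trans (head_weight_le _ _) _; rewrite zb bE eqxx -/f -/z; lia.
have [z0 fz1] : 0 < z /\ f z = 1.
  have [h|h] := boolP ((z == 0) || (1 < f z)); last by lia.
  move/negP: aF; case; rewrite eF; apply: asym_set_nth => //; first by have := ak z zn; lia.
  by apply: first_nonmin => //; case/orP: h => [/eqP|]; [left|right].
(* If [j < n - 2], then [f (n - 2) = k - 1] would exceed [f z = 1]. *)
have ej : j = n - 2.
  apply/eqP; rewrite eqn_leq; apply/andP; split; first by lia.
  rewrite leqNgt; apply/negP=> lt; have := fS ltac:(lia); rewrite hj; lia.
have ei : i = n - 3 by lia.
have k_3 : k = 3 by have := fS ltac:(lia); rewrite -ej fj2; lia.
have f0 : f 0 = 0 by apply: fz0.
have f3 : f (n - 3) = 0 by rewrite -ei -(subn0 i) pal.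
have zn3 : z < n - 3.
  rewrite ltn_neqAle -ltnS (_ : (n - 3).+1 = j) ?nzj ?andbT; last by lia.
  by apply/eqP=> e; move: fz; rewrite e; lia.
(* By the palindrome this symbol is [f 1], which is 1 if [z = 1] and 0 otherwise. *)
have f4 : f (n - 4) <> 2.
  rewrite (_ : n - 4 = i - 1) ?pal; try lia.
  have [z1|z1] : z = 1 \/ 1 < z by lia.
    by have := fz1; rewrite z1 => ->.
  by rewrite fz0.
have eS : SecondLastNonMax k a = set_nth 0 a (n - 3) 1.
  rewrite /SecondLastNonMax (_ : nonmax_idx k a =
    filter (fun i => f i != k - 1) (iota 0 (n - 3)) ++ [:: n - 3; n - 2]).
    by rewrite size_cat /= addnK nth_cat ltnn subnn addn2 /= -/f f3.
  rewrite /nonmax_idx sa {1}(_ : n = n - 3 + 3); last by lia.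
  rewrite iotaD filter_cat add0n /= -/f f3 (_ : (n - 3).+1 = n - 2) -?ej ?fj2; try lia.
  rewrite (_ : j.+1 = n - 1); last by lia.
  by rewrite fn1 eqxx k_3.
have aSL : asym_bracelet k n (SecondLastNonMax k a).
  rewrite eS; apply: asym_set_nth => //; try lia.
  by apply: second_last_nonmax => //; rewrite -/f ?fn1 -?ej ?fj2; lia.
rewrite aSL /=; split=> //; rewrite eS.
  by apply: closer_incr => //; rewrite ?sa -/f ?f3 -/z; lia.
by apply: one_change_set_nth; rewrite -/f ?f3; lia.
Qed.

(** * Termination and the theorem *)

Lemma closer_irr k a : ~ closer k a a.
Proof. by rewrite /closer; lia. Qed.

Lemma sumn_le k a : all (fun x => x < k) a -> sumn a <= size a * k.
Proof. by elim: a => //= x a IH /andP[xk /IH]; rewrite mulSn; lia. Qed.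

Lemma Par_iter n k a : 3 <= n -> 3 <= k -> asym_bracelet k n a ->
  exists t, iter t (Par k n) a = rnk n k.
Proof.
move=> n3 k3.
(* Lexicographic induction by three nested bounds: an improved component releases the bounds on the
   later ones. *)
have [N] := ubnP (n - leading_zeros a); elim: N a => // N IHN a.
have [M] := ubnP (head_weight k a); elim: M a => // M IHM a.
have [S] := ubnP (n * k - sumn a); elim: S a => // S IHS a le_S le_M le_N asym_a.
have [->|/eqP ne] := eqVneq a (rnk n k); first by exists 0.
have [asym_b cl _] := Par_step n3 k3 asym_a ne; set b := Par k n a in asym_b cl.
suff [t e] : exists t, iter t (Par k n) b = rnk n k by exists t.+1; rewrite iterSr.
have n0 : 0 < n by lia.
have [zb _ _] := leading_zerosP n0 asym_b.
case: cl => [lt|[ez [lt|[le lt]]]].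
- by apply: IHN => //; lia.
- by apply: IHM => //; lia.
apply: IHS => //; try lia.
case/and3P: asym_b => /andP[/eqP sb /sumn_le]; rewrite sb; lia.
Qed.

Theorem mainTheorem9 (n k : nat) : 3 <= n -> 3 <= k ->
  [/\ asym_bracelet k n (rnk n k),
      (forall a, asym_bracelet k n a -> a != rnk n k ->
          has (asym_bracelet k n) (candidates k a)),
      (forall a, asym_bracelet k n a -> a != rnk n k ->
          asym_bracelet k n (Par k n a)),
      (forall a, asym_bracelet k n a ->
          exists t, iter t (Par k n) a = rnk n k) &
      (forall a, asym_bracelet k n a -> a != rnk n k ->
          exists i j, head 0 (rot i a) != head 0 (rot j (Par k n a)) /\
                      behead (rot i a) = behead (rot j (Par k n a)))].
Proof.
move=> n3 k3; split=> [|a as_a /eqP ne|a as_a /eqP ne|a as_a|a as_a /eqP ne].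
- exact: asym_rnk.
(* Without a valid candidate [Par] would return its default [a], which is not [closer] than
   itself. *)
- have [_ + _] := Par_step n3 k3 as_a ne; rewrite has_filter /Par.
  by case: (filter _ _) => //= /closer_irr.
- by have [] := Par_step n3 k3 as_a ne.
- exact: Par_iter.
have [_ _ oc] := Par_step n3 k3 as_a ne.
by apply: one_change_heads oc; have [] := (asymP k n a).1 as_a.
Qed.
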